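(* Let $X$ be a set endowed with two arbitrary multivalued binary operations $\oplus$ and $\otimes$ and two fixed different points $\xi_0$ and $\xi_1$. Denote by $S(X)$ (resp. $S(X)_{pr}$) the set of all (resp. all proper) prime ideals in $(X,\oplus,\otimes)$. Let $\mathcal{T}^+$ (resp. $\mathcal{T}^-$) be the topology on $S(X)$ having as a subbase the sets $\{p\in S(X): x\notin p\}$ (resp. $\{p\in S(X): x\in p\}$), $x\in X$, and define the topologies $\mathcal{T}^+_{pr}$ and $\mathcal{T}^-_{pr}$ on $S(X)_{pr}$ in the same way, with $S(X)_{pr}$ in place of $S(X)$. Then the bitopological spaces $(S(X),\mathcal{T}^+,\mathcal{T}^-)$ and $(S(X)_{pr},\mathcal{T}^+_{pr},\mathcal{T}^-_{pr})$ are abstract spectra.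
   Context: A multivalued binary operation on $X$ assigns to each pair $x,y\in X$ a subset of $X$. A subset $p\subseteq X$ is a prime ideal in $(X,\oplus,\otimes)$ if: (i) $x,y\in p$ implies $x\oplus y\subseteq p$; (ii) $(x\otimes y)\cap p\neq\emptyset$ implies $x\in p$ or $y\in p$. It is proper if $\xi_0\in p$ and $\xi_1\notin p$. The topology with a given family as subbase is the one generated by that family (the whole set is the empty intersection). Compact means that every open cover has a finite subcover. For a bitopological space $(S,\mathcal{T}^+,\mathcal{T}^-)$ (a set with two topologies) put $\mathcal{L}^+=\{U\in\mathcal{T}^+: S\setminus U\in\mathcal{T}^-\}$ and $\mathcal{L}^-=\{U\in\mathcal{T}^-: S\setminus U\in\mathcal{T}^+\}$. A non-empty bitopological space is an abstract spectrum if: (SP1) $\mathcal{L}^+$ is a base for $\mathcal{T}^+$ and $\mathcal{L}^-$ is a base for $\mathcal{T}^-$; (SP2) if $F\subseteq S$ and $S\setminus F\in\mathcal{T}^+$ (resp. $S\setminus F\in\mathcal{T}^-$) then $F$ is a compact subset of $(S,\mathcal{T}^-)$ (resp. of $(S,\mathcal{T}^+)$); (SP3) at least one of $(S,\mathcal{T}^+)$, $(S,\mathcal{T}^-)$ is a $T_0$-space.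
   Formalization: The claim for S(X)_pr is proved under the added hypothesis that S(X)_pr is non-empty; it can be empty (e.g. when ξ₁ ∈ ξ₀⊕ξ₀), and an abstract spectrum is non-empty by definition. *)

(* Defs.v *)
From HB Require Import structures.
From mathcomp Require Import all_boot all_order all_classical topology.

Set Implicit Arguments.
Unset Strict Implicit.
Unset Printing Implicit Defensive.

Local Open Scope classical_set_scope.

Section Ideals.
Context {X : Type}.
Variables (oplus otimes : X -> X -> set X).

Definition prime_ideal (p : set X) : Prop :=
  (forall x y, p x -> p y -> oplus x y `<=` p) /\
  (forall x y, (otimes x y `&` p) !=set0 -> p x \/ p y).

Definition prime_ideals : set (set X) := [set p | prime_ideal p].

(* May be empty, e.g. when xi1 \in oplus xi0 xi0, whereas set0 is always a
   prime ideal. *)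
Definition proper_prime_ideals (xi0 xi1 : X) : set (set X) :=
  [set p | [/\ prime_ideal p, p xi0 & ~ p xi1]].

End Ideals.

(* A copy of T carrying the topology with subbase B; the factory's finite
   intersections include the empty one, which is the whole of T. *)
Definition generated_space {T : Type} (B : set (set T)) : Type := T.

Section GeneratedTopology.
Context {T : choiceType}.
Variable B : set (set T).

HB.instance Definition _ := Choice.on (generated_space B).
HB.instance Definition _ :=
  isSubBaseTopological.Build (generated_space B) B id.

Definition generated_topology : Topological T :=
  Topological.class (generated_space B : topologicalType).

End GeneratedTopology.

(* A bitopological space is a type S with two Topological structures; each
   half is repacked as a topologicalType so that the library's topological
   notions can be used on it. *)
Section Bitopological.
Context {S : Type}.
Implicit Types Ta Tb Tp Tm : Topological S.

Definition open_in Ta : set (set S) := @open (Topological.Pack Ta).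

(* L^+ is co_open_opens Tp Tm and L^- is co_open_opens Tm Tp. *)
Definition co_open_opens Ta Tb : set (set S) :=
  [set U | open_in Ta U /\ open_in Tb (~` U)].

Definition base_of Ta (B : set (set S)) : Prop :=
  @basis (Topological.Pack Ta) B.

(* [cover_compact] is the open-cover form of compactness; [compact] is defined
   in the library by cluster points of filters. *)
Definition compact_in Ta (F : set S) : Prop :=
  @cover_compact (Topological.Pack Ta) F.

Definition T0_in Ta : Prop := kolmogorov_space (Topological.Pack Ta).

Record abstract_spectrum Tp Tm : Prop := AbstractSpectrum {
  spectrum_nonempty : [set: S] !=set0;
  spectrum_SP1 :
    base_of Tp (co_open_opens Tp Tm) /\ base_of Tm (co_open_opens Tm Tp);
  spectrum_SP2 : forall F : set S,
    (open_in Tp (~` F) -> compact_in Tm F) /\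
    (open_in Tm (~` F) -> compact_in Tp F);
  spectrum_SP3 : T0_in Tp \/ T0_in Tm }.

End Bitopological.

Section SpectralTopologies.
Context {X : Type}.
Variable A : set (set X).

Definition spec_plus : Topological (set_type A) :=
  generated_topology [set [set p : set_type A | ~ set_val p x] | x in [set: X]].

Definition spec_minus : Topological (set_type A) :=
  generated_topology [set [set p : set_type A | set_val p x] | x in [set: X]].

End SpectralTopologies.

(* Main.v *)
(** Two topologies with complementary subbases satisfy (SP1) at once, and (SP2)
    as soon as every ultrafilter converges in both of them to a common point.
    For a set of subsets of X, the candidate limit of an ultrafilter U is the
    set of those x that belong to U-almost every p. The axioms of a (proper)
    prime ideal are finite Boolean clauses, so they pass to this limit:
    implications between memberships because U is a filter, the disjunction in
    (ii) because U is an ultrafilter. *)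

From HB Require Import structures.
Require Import Defs.
From mathcomp Require Import all_boot all_order all_classical topology.

Local Open Scope classical_set_scope.

(** [compact_cover] is stated for pointed spaces; any point [t] of [T] gives that structure and
    leaves the topology unchanged. *)
Lemma compact_cover_nonempty (T : topologicalType) (F : set T) :
  [set: T] !=set0 -> compact F -> cover_compact F.
Proof.
move=> [t _].
pose pT : ptopologicalType := HB.pack T (isPointed.Build T t).
by rewrite -[cover_compact F]/(@cover_compact pT F) -compact_cover.
Qed.

Lemma finI_from_ind (I : choiceType) (T : Type) (D : set I) (f : I -> set T)
    (P : set T -> Prop) :
  P setT -> (forall V W, P V -> P W -> P (V `&` W)) ->
  (forall i, D i -> P (f i)) -> forall V, finI_from D f V -> P V.
Proof.
move=> PT PI Pf _ [D' D'D <-]; rewrite bigcap_fset.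
by rewrite big_seq; apply: big_ind => // i /D'D/set_mem; exact: Pf.
Qed.

Section GeneratedTopology.
Context {T : choiceType}.
Implicit Types (B : set (set T)) (U V : set T).

Lemma generated_openP B U :
  open_in (generated_topology B) U <->
  forall x, U x -> exists V, [/\ finI_from B id V, V x & V `<=` U].
Proof.
split=> [[D' D'B <-] x [V D'V Vx]|UB].
  by exists V; split=> //; [exact: D'B|exact: bigcup_sup].
exists [set V | finI_from B id V /\ V `<=` U] => [V []//|].
rewrite eqEsubset; split=> [x [V [_ VU] /VU]//|x /UB[V [BV Vx VU]]].
by exists V.
Qed.

Lemma generated_open_subbase B V : B V -> open_in (generated_topology B) V.
Proof.
move=> BV; apply/generated_openP => x Vx; exists V; split=> //.
exact: (finI_from1 id BV).
Qed.

(** Convergence need only be tested on the subbase: filters are stable under finite intersections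
    and supersets. *)
Lemma generated_filter_open B (U : set_system T) (q : T) : Filter U ->
  (forall V, B V -> V q -> U V) ->
  forall W, open_in (generated_topology B) W -> W q -> U W.
Proof.
move=> FU BU W /generated_openP oW /oW [V [BV Vq VW]].
apply: filterS VW _; elim/finI_from_ind: V / BV Vq => //.
- by move=> _; exact: filterT.
- by move=> V1 V2 IH1 IH2 [/IH1 ? /IH2 ?]; exact: filterI.
Qed.

Lemma generated_basis B (D : set (set T)) :
  D `<=` open_in (generated_topology B) -> D setT ->
  (forall V W, D V -> D W -> D (V `&` W)) -> B `<=` D ->
  base_of (generated_topology B) D.
Proof.
move=> oD DT DI BD; split=> // x W.
rewrite nbhsE => -[O [/generated_openP oO /oO [V [BV Vx VO]]] OW].
exists V; last by move=> y /VO /OW.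
by split=> //; elim/finI_from_ind: V / BV {Vx VO} => // V /BD.
Qed.

(** An ultrafilter containing [F] converges to [q] for both subbases. Convergence for [C] puts [q]
    in the [C]-closed set [F]; convergence for [B] then gives compactness. *)
Lemma generated_compact B C :
  [set: T] !=set0 ->
  (forall U : set_system T, UltraFilter U ->
    exists q, forall V, B V \/ C V -> V q -> U V) ->
  forall F, open_in (generated_topology C) (~` F) ->
    compact_in (generated_topology B) F.
Proof.
move=> T0 ultra_lim F oF; apply: compact_cover_nonempty => //.
rewrite compact_ultra => U UU UF; have [q qU] := ultra_lim U UU.
exists q; split.
  apply: contrapT => nFq.
  have UnF : U (~` F).
    by apply: generated_filter_open oF nFq => V CV; apply: qU; right.
  by have [x []] := filter_ex (filterI UF UnF).
move=> W; rewrite nbhsE => -[O [oO Oq] OW]; apply: filterS OW _.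
by apply: generated_filter_open oO Oq => V BV; apply: qU; left.
Qed.

(** The co-open sets contain the subbase [B] and are stable under finite intersections, since
    complements turn these into finite unions. *)
Lemma generated_co_open_basis B C :
  (forall V, B V -> C (~` V)) ->
  base_of (generated_topology B)
    (co_open_opens (generated_topology B) (generated_topology C)).
Proof.
move=> BC; apply: generated_basis => [V []//||V W [oV oV'] [oW oW']|V BV].
- by split; [exact: openT|rewrite setCT; exact: open0].
- by split; [exact: openI|rewrite setCI; exact: openU].
- by split; apply: generated_open_subbase => //; exact: BC.
Qed.

Lemma generated_T0 B :
  (forall x y, x <> y -> exists2 V, B V & V x /\ ~ V y \/ V y /\ ~ V x) ->
  T0_in (generated_topology B).
Proof.
move=> sep x y /eqP /sep [V BV Vxy]; exists V.
have nbhsV z : V z -> V \in @nbhs _ (generated_space B) z.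
  by move=> Vz; rewrite inE; apply: open_nbhs_nbhs; split=> //;
    exact: generated_open_subbase.
by case: Vxy => -[V1 V2]; [left|right]; rewrite nbhsV// inE.
Qed.

Lemma complementary_subbases_spectrum B C :
  [set: T] !=set0 ->
  (forall V, B V -> C (~` V)) -> (forall V, C V -> B (~` V)) ->
  (forall U : set_system T, UltraFilter U ->
    exists q, forall V, B V \/ C V -> V q -> U V) ->
  (forall x y, x <> y -> exists2 V, B V & V x /\ ~ V y \/ V y /\ ~ V x) ->
  abstract_spectrum (generated_topology B) (generated_topology C).
Proof.
move=> T0 BC CB ultra_lim sep; split=> //.
- by split; exact: generated_co_open_basis.
(* The limit condition is symmetric in [B] and [C], so one argument serves both halves of (SP2). *)
- move=> F; split; apply: generated_compact => // U /ultra_lim [q qU].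
  by exists q => V /or_comm; exact: qU.
- by left; exact: generated_T0.
Qed.

End GeneratedTopology.

(** This is closedness of [A] in the power set of [X], viewed as the product of copies of the
    discrete space {0,1}, expressed by limits of ultrafilters. *)
Definition ultra_closed {X : Type} (A : set (set X)) : Prop :=
  forall U : set_system (set_type A), UltraFilter U ->
  A [set x | U [set p | set_val p x]].

Lemma ultra_closed_spectrum (X : Type) (A : set (set X)) :
  A !=set0 -> ultra_closed A -> abstract_spectrum (spec_plus A) (spec_minus A).
Proof.
move=> [p0 Ap0] clA; apply: complementary_subbases_spectrum.
- by exists (SigSub (mem_set Ap0)).
- move=> _ [x _ <-]; exists x => //.
  by rewrite eqEsubset; split=> p /=; [move=> ? ; exact|exact: contrapT].
- by move=> _ [x _ <-]; exists x.
(* For the sets [p x] convergence is the definition of the limit; for their complements it is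
   maximality of [U]. *)
- move=> U UU; exists (SigSub (mem_set (clA U UU))) => V [] [x _ <-] //= nUx.
  by have [] := in_ultra_setVsetC [set p : set_type A | set_val p x] UU.
- move=> p q pq; apply: contrapT => nsep; apply/pq/val_inj.
  rewrite predeqE => x; split=> px; apply: contrapT => nqx; apply: nsep;
    exists [set r : set_type A | ~ set_val r x]; try by exists x.
  + by right; split=> // /(_ px).
  + by left; split=> // /(_ px).
Qed.

Section PrimeIdeals.
Context {X : Type}.
Variables oplus otimes : X -> X -> set X.

(** A general subfamily [A] is allowed so that the lemma also covers ultrafilters on the proper
    prime ideals. *)
Lemma ultra_limit_prime_ideal (A : set (set X)) (U : set_system (set_type A)) :
  UltraFilter U -> A `<=` prime_ideals oplus otimes ->
  prime_ideal oplus otimes [set x | U [set p | set_val p x]].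
Proof.
move=> UU Apr; have primeA (p : set_type A) := Apr _ (set_valP p).
split=> [x y Ux Uy z xyz|x y [z [xyz Uz]]].
  apply: filterS (filterI Ux Uy) => p [px py].
  by have [+ _] := primeA p; apply; [exact: px|exact: py|].
have [|Unx] := in_ultra_setVsetC [set p : set_type A | set_val p x] UU.
  by left.
(* The single element [z] of [otimes x y] witnesses the premise of (ii) for almost every [p], and
   almost every [p] omits [x]. *)
right; apply: filterS (filterI Uz Unx) => p [pz npx].
have [_ /(_ x y)[|//|//]] := primeA p.
by exists z.
Qed.

Lemma prime_ideals_ultra_closed : ultra_closed (prime_ideals oplus otimes).
Proof. by move=> U UU; exact: ultra_limit_prime_ideal. Qed.

Lemma proper_prime_ideals_ultra_closed (xi0 xi1 : X) :
  ultra_closed (proper_prime_ideals oplus otimes xi0 xi1).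
Proof.
move=> U UU; split.
- by apply: ultra_limit_prime_ideal => // p [].
- by apply: filterE => p; have [] := set_valP p.
(* A set in [U] is non-empty, so some proper [p] would contain [xi1]. *)
- by move=> /filter_ex [p pxi1]; have [_ _] := set_valP p; exact.
Qed.

End PrimeIdeals.

(** Abstract spectra are non-empty by definition, hence the condition on the second half. *)
Theorem theorem2p2p4 (X : Type) (oplus otimes : X -> X -> set X)
    (xi0 xi1 : X) (hxi : xi0 <> xi1) :
  abstract_spectrum (spec_plus (prime_ideals oplus otimes))
                    (spec_minus (prime_ideals oplus otimes)) /\
  (proper_prime_ideals oplus otimes xi0 xi1 !=set0 ->
   abstract_spectrum (spec_plus (proper_prime_ideals oplus otimes xi0 xi1))
                     (spec_minus (proper_prime_ideals oplus otimes xi0 xi1))).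
Proof.
split=> [|A0]; apply: ultra_closed_spectrum => //.
(* Both clauses are vacuous for the empty set, which has no elements and meets no product. *)
- by exists set0; split=> // x y [z []].
- exact: prime_ideals_ultra_closed.
- exact: proper_prime_ideals_ultra_closed.
Qed.
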